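(* Let $T$ be a rising tree with Farey-indexed numbers $m_q$ and encoding function $\Phi$, and let $\alpha=[0,a_1,a_2,\dots]\in(0,1)$ be irrational with convergents $C_j=u_j/v_j$. Then $$\Phi(\alpha)=(u_1-v_1\alpha)\rho(m_0)+\alpha\cdot\rho(m_{C_1})+\sum_{j\ge1}(-1)^j(v_j\alpha-u_j)\,\Delta^*(C_{j+1}),$$ $$\Phi'(\alpha)=\rho(m_{C_1})-a_1\rho(m_0)+\sum_{j\ge1}(-1)^jv_j\,\Delta^*(C_{j+1}).$$ Restricting each of these two series to $1\le j\le m$ makes an error of size $O(e^{-2\omega_Tv_m})$.
   Context: All fractions $k/n$ are in lowest terms with $n\ge1$. Two fractions $a/b<c/d$ in $[0,1]$ are Farey neighbours if $bc-ad=1$; their mediant is $(a+c)/(b+d)$. Each $q\in\mathbb Q\cap(0,1)$ is the mediant of a unique pair of Farey neighbours in $[0,1]$, denoted $q_0<q_0'$. Let $\rho(x)=\cosh^{-1}(x/2)$ for $x\ge2$. A real Markov tree $T$ with base triple $(s_0,u_0,t_0)\in\mathbb R^3$ is a rooted planar trivalent tree (the root has degree 1, all other vertices degree 3) whose complementary regions carry real labels; the root edge has the region $s_0$ on its left, $t_0$ on its right, and leads to the region $u_0$; and for every non-root edge, with regions $s,t$ on its two sides and $r,u$ at its two ends, $r+u=st$. The regions are Farey-indexed by $\mathbb Q\cap[0,1]$, writing $m_q=m(T)_q$: $m_0=s_0$, $m_{1/2}=u_0$, $m_1=t_0$, and for each $q\in\mathbb Q\cap(0,1)$, if $p$ is the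 mediant of $q_0,q$ and $p'$ the mediant of $q,q_0'$, then $m_p=m_{q_0}m_q-m_{q_0'}$ and $m_{p'}=m_qm_{q_0'}-m_{q_0}$. The non-root vertices correspond to $q\in\mathbb Q\cap(0,1)$: the regions $q_0,q,q_0'$ meet at vertex $q$. Let $e_q$ be the edge at vertex $q$ on the side of the root. It is (positively) directed away from the root if $2m_q-m_{q_0}m_{q_0'}>0$, towards the root if this is negative, and undirected if it is $0$. $T$ is a rising tree if all labels are $>2$ and all edges are positively directed away from the root except for those on a finite (possibly empty) simple path starting at the root. The encoding function $\Phi=\Phi_T:[0,1]\to\mathbb R_{\ge0}$ is the unique continuous function with $\Phi(k/n)=\rho(m_{k/n})/n$ for all $k/n\in\mathbb Q\cap[0,1]$; it exists for rising trees and is differentiable at every irrational in $(0,1)$. Continued fractions are standard, with integers $a_i\ge1$ for $i\ge1$; $C_j=u_j/v_j=[0,a_1,\dots,a_j]$ in lowest terms, with $C_0=0/1$. For $j\ge1$, $$\Delta^*(C_{j+1})=\rho(m_{C_{j+1}})-a_{j+1}\,\rho(m_{C_j})-\rho(m_{C_{j-1}}).$$ $\omega_T>0$ is a constant such that $e^{\omega_Tn}<m(T)_{k/n}$ for all $k/n\in\mathbb Q\cap[0,1]$ (such a constant exists for every rising tree). *)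

(* Defs.v *)
From HB Require Import structures.
From mathcomp Require Export all_boot all_order all_algebra.
From mathcomp Require Export all_classical all_reals all_analysis.
Export Order.TTheory GRing.Theory Num.Theory.
Export numFieldNormedType.Exports.

Set Implicit Arguments.
Unset Strict Implicit.
Unset Printing Implicit Defensive.

Local Open Scope classical_set_scope.
Local Open Scope ring_scope.

(* Farey fractions: [numq] and [denq] are the numerator and the (positive)
   denominator in lowest terms. *)

Definition farey_neighbours (p q : rat) : Prop :=
  [/\ 0 <= p, p < q, q <= 1 & denq p * numq q - numq p * denq q = 1].

Definition mediant (p q : rat) : rat :=
  (numq p + numq q)%:~R / (denq p + denq q)%:~R.

(* [farey_parents q q0 q0'] : q0 and q0' are the two Farey neighbours of which
   q is the mediant; such a pair exists, and is unique, exactly when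
   0 < q < 1. *)
Definition farey_parents (q q0 q0' : rat) : Prop :=
  farey_neighbours q0 q0' /\ q = mediant q0 q0'.

(* The rooted planar trivalent tree is encoded by its Farey indexing: regions
   are the rationals of [0, 1], non-root vertices are the rationals of ]0, 1[,
   and the vertex q stands for the edge e_q that joins it to its parent.
   [tree_child q p] : the vertex p is one of the two children of q. *)
Definition tree_child (q p : rat) : Prop :=
  exists q0 q0', farey_parents q q0 q0' /\ (p = mediant q0 q \/ p = mediant q q0').

(* The edges e_q, q in s, taken in order, form a simple path which starts at the
   root (s may be empty); the root edge is e_(1/2). *)
Definition root_path (s : seq rat) : Prop :=
  ((0 < size s)%N -> nth 0 s 0 = 1 / 2) /\
  (forall i, (i.+1 < size s)%N -> tree_child (nth 0 s i) (nth 0 s i.+1)).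

Section MarkovTree.
Context {R : realType}.
Implicit Types (m : rat -> R) (a : nat -> nat).

(* Only the values of the labelling m at the rationals of [0, 1] are labels. *)
Definition markov_tree (s0 u0 t0 : R) m : Prop :=
  [/\ m 0 = s0, m (1 / 2) = u0, m 1 = t0 &
      forall q q0 q0', farey_parents q q0 q0' ->
        m (mediant q0 q) = m q0 * m q - m q0' /\
        m (mediant q q0') = m q * m q0' - m q0].

(* e_q is positively directed away from the root *)
Definition directed_away m (q : rat) : Prop :=
  forall q0 q0', farey_parents q q0 q0' -> 0 < 2 * m q - m q0 * m q0'.

Definition rising m : Prop :=
  (forall q, 0 <= q <= 1 -> 2 < m q) /\
  (exists2 s : seq rat, root_path s &
     forall q, 0 < q < 1 -> q \notin s -> directed_away m q).

Definition cosh (y : R) : R := (expR y + expR (- y)) / 2.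

Definition arcosh (x : R) : R := get [set y | 0 <= y /\ cosh y = x].

Definition rho (x : R) : R := arcosh (x / 2).

Definition encoding_function m (Phi : R -> R) : Prop :=
  [/\ {within `[0, 1], continuous Phi},
      forall x, 0 <= x <= 1 -> 0 <= Phi x &
      forall q : rat, 0 <= q <= 1 -> Phi (ratr q) = rho (m q) / (denq q)%:~R].

(* [cfrac [:: a_1; ...; a_j]] is the continued fraction [0, a_1, ..., a_j] *)
Fixpoint cfrac (s : seq nat) : rat :=
  if s is b :: s' then (b%:R + cfrac s')^-1 else 0.

(* C_j for [0, a_1, a_2, ...]; the value a 0 is not used *)
Definition convergent a (j : nat) : rat := cfrac [seq a i | i <- iota 1 j].

Definition has_cfrac (alpha : R) a : Prop :=
  (forall i, (1 <= i)%N -> (1 <= a i)%N) /\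
  (ratr (convergent a j) : R) @[j --> \oo] --> alpha.

Definition conv_num a j : R := (numq (convergent a j))%:~R.
Definition conv_den a j : R := (denq (convergent a j))%:~R.

(* [Delta_star m a j.+1] is Delta^*(C_(j+1)), for j >= 1 *)
Definition Delta_star m a (k : nat) : R :=
  rho (m (convergent a k)) - (a k)%:R * rho (m (convergent a k.-1))
  - rho (m (convergent a k.-2)).

(* Partial sums, over 1 <= j <= M, of the two series *)
Definition value_sum m a (alpha : R) (M : nat) : R :=
  \sum_(1 <= j < M.+1)
    (-1) ^+ j * (conv_den a j * alpha - conv_num a j) * Delta_star m a j.+1.

Definition slope_sum m a (M : nat) : R :=
  \sum_(1 <= j < M.+1) (-1) ^+ j * conv_den a j * Delta_star m a j.+1.

End MarkovTree.

(* Main.v *)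
(* Write Phi on a Farey interval [p, p'] with denominators d, d' as its chord
   plus an error.  The cubic x^2 + y^2 + z^2 - xyz of the labels at a vertex is
   constant on the tree; with labels 2 cosh it factors, which shows that at an
   edge directed away from the root
     rho(z) = rho(x) + rho(y) + O(exp(-2 w (d + d')))
   when labels grow like exp(w n).  Each mediant therefore changes the chord
   slope by a summable amount, so Phi minus its chord is Lipschitz on [p, p']
   with constant O(exp(-w (d + d'))).  The partial sums of the two series
   telescope: they are the value at alpha, and the slope, of the chord of Phi
   over the interval between C_M and C_(M+1).  Growth of the labels holds because
   ln(m/2) is superadditive where edges point away from the root. *)
Require Import Defs.
From mathcomp Require Import zify ring lra.
Set Implicit Arguments.
Unset Strict Implicit.
Unset Printing Implicit Defensive.
Local Open Scope classical_set_scope.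
Local Open Scope ring_scope.

(** * Farey neighbours *)

Lemma ltq_cross (p q : rat) : (p < q) = (numq p * denq q < numq q * denq p).
Proof. exact: lt_ratE. Qed.

Lemma leq_cross (p q : rat) : (p <= q) = (numq p * denq q <= numq q * denq p).
Proof. exact: le_ratE. Qed.

(** A Bezout relation certifies lowest terms. The determinant identities below are such relations,
    so numerators and denominators of mediants and convergents can be read off. *)
Lemma bezout_fraction (n d u v : int) : 0 < d -> u * n + v * d = 1 ->
  numq (n%:~R / d%:~R) = n /\ denq (n%:~R / d%:~R) = d.
Proof.
move=> d0 uv; have cop : coprime `|n| `|d|.
  by rewrite -coprimezE; apply/coprimezP; exists (u, v).
rewrite coprimeq_num // coprimeq_den // gtr0_sg // mul1r gt_eqF //.
by rewrite gtr0_norm.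
Qed.

Lemma mediant_num_den (p q : rat) : farey_neighbours p q ->
  numq (mediant p q) = numq p + numq q /\ denq (mediant p q) = denq p + denq q.
Proof.
case=> p0 pq q1 det; have := denq_gt0 p; have := denq_gt0 q => dq dp.
apply: (@bezout_fraction _ _ (denq p) (- numq p)); first by rewrite addr_gt0.
by rewrite -det; ring.
Qed.

Lemma farey_mediant (p q : rat) : farey_neighbours p q ->
  farey_neighbours p (mediant p q) /\ farey_neighbours (mediant p q) q.
Proof.
move=> pq; have [num den] := mediant_num_den pq.
case: pq => p0 pq q1 det.
have pm : p < mediant p q by rewrite ltq_cross num den; lia.
have mq : mediant p q < q by rewrite ltq_cross num den; lia.
split; split; rewrite ?num ?den //; try lia.
- by rewrite (le_trans _ q1) ?ltW.
- by rewrite (le_trans p0) ?ltW.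
Qed.

Lemma farey_parents_mediant (p q : rat) : farey_neighbours p q ->
  farey_parents (mediant p q) p q.
Proof. by []. Qed.

(** As the determinant is 1, [denq x] is a combination of [denq p] and [denq q] whose coefficients
    are the determinants of [x] against [q] and against [p]: positive integers when [x] lies
    strictly between. *)
Lemma farey_den_between (p q x : rat) : farey_neighbours p q -> p < x < q ->
  denq p + denq q <= denq x.
Proof.
case=> p0 pq q1 det /andP[]; rewrite !ltq_cross => px xq.
have -> : denq x = denq p * (numq q * denq x - numq x * denq q)
                 + denq q * (numq x * denq p - numq p * denq x).
  by rewrite -[LHS]mulr1 -det; ring.
have := denq_gt0 p; have := denq_gt0 q => dq dp.
apply: lerD; apply: ler_peMr; lia.
Qed.

Lemma farey_den_ge (p q x : rat) : farey_neighbours p q -> p <= x <= q ->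
  Num.min (denq p) (denq q) <= denq x.
Proof.
move=> pq /andP[]; rewrite le_eqVlt => /predU1P[<- _|px].
  by rewrite ge_min lexx.
rewrite le_eqVlt => /predU1P[->|xq]; first by rewrite ge_min lexx orbT.
have /(farey_den_between pq) : p < x < q by rewrite px.
by have := denq_gt0 p; have := denq_gt0 q; lia.
Qed.

Lemma farey_endpoints (p q x : rat) : farey_neighbours p q ->
  p <= x -> x <= q -> denq x < denq p + denq q -> x = p \/ x = q.
Proof.
move=> nb; rewrite le_eqVlt => /predU1P[->|px]; first by left.
rewrite le_eqVlt => /predU1P[->|xq]; first by right.
by rewrite ltNge (farey_den_between nb) // px.
Qed.

(* Both inductions descend the Farey tree; they terminate because a fraction
   strictly between two neighbours has denominator at least the sum of theirs. *)
Lemma farey_point_ind (A : rat -> Prop) (p0 q0 : rat) :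
  farey_neighbours p0 q0 -> A p0 -> A q0 ->
  (forall p q, farey_neighbours p q -> p0 <= p -> q <= q0 ->
     A p -> A q -> A (mediant p q)) ->
  forall x, p0 <= x <= q0 -> A x.
Proof.
move=> nb0 Ap0 Aq0 step x xin.
suff main (n : nat) p q : farey_neighbours p q -> p0 <= p -> q <= q0 ->
    A p -> A q -> p <= x <= q -> denq x < denq p + denq q + n%:Z -> A x.
  by apply: (main `|denq x|%N p0 q0) => //; have := denq_gt0 p0; have := denq_gt0 q0; lia.
elim: n p q => [|n IH] p q nb pp0 qq0 Ap Aq /andP[px xq] lt_n.
  by rewrite addr0 in lt_n; case: (farey_endpoints nb px xq lt_n) => ->.
have [nbl nbr] := farey_mediant nb.
have [num den] := mediant_num_den nb.
have [dp dq] := (denq_gt0 p, denq_gt0 q).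
have Ar := step _ _ nb pp0 qq0 Ap Aq.
have [pr rq] : p < mediant p q /\ mediant p q < q by case: nbl nbr => _ ? _ _ [].
have [xr|rx] := leP x (mediant p q).
  by apply: (IH _ _ nbl) => //; rewrite ?px ?den //; [apply: (le_trans (ltW rq))|lia].
apply: (IH _ _ nbr) => //; rewrite ?(ltW rx) ?den //; last lia.
exact: (le_trans pp0 (ltW pr)).
Qed.

Lemma farey_pair_ind (P : rat -> rat -> Prop) (p0 q0 : rat) :
  farey_neighbours p0 q0 -> P p0 q0 ->
  (forall p q, farey_neighbours p q -> P p q ->
     P p (mediant p q) /\ P (mediant p q) q) ->
  forall p q, farey_neighbours p q -> p0 <= p -> q <= q0 -> P p q.
Proof.
move=> nb0 P0 step p q nb pp0 qq0.
suff main (n : nat) p1 q1 : farey_neighbours p1 q1 -> P p1 q1 -> p1 <= p ->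
    q <= q1 -> denq p + denq q < denq p1 + denq q1 + n%:Z -> P p q.
  apply: (main (`|denq p| + `|denq q|)%N p0 q0) => //.
  by have := denq_gt0 p0; have := denq_gt0 q0; have := denq_gt0 p; have := denq_gt0 q; lia.
have pq : p < q by case: nb.
have [dp dq] := (denq_gt0 p, denq_gt0 q).
elim: n p1 q1 => [|n IH] p1 q1 nb1 P1 pp qq lt_n.
  have [p1p|p1p] := eqVneq p1 p; have [q1q|q1q] := eqVneq q1 q.
  - by rewrite -p1p -q1q.
  - subst p1; have := @farey_den_between _ _ q nb1.
    by rewrite [q < q1]lt_neqAle eq_sym q1q qq pq => /(_ isT); lia.
  - subst q1; have := @farey_den_between _ _ p nb1.
    by rewrite [p1 < p]lt_neqAle p1p pp pq => /(_ isT); lia.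
  - have := @farey_den_between _ _ p nb1; rewrite [p1 < p]lt_neqAle p1p pp.
    by rewrite (lt_le_trans pq qq) => /(_ isT); have := denq_gt0 p1; lia.
have [p1p|p1p] := eqVneq p1 p; have [q1q|q1q] := eqVneq q1 q.
- by rewrite -p1p -q1q.
all: have [Pl Pr] := step _ _ nb1 P1.
all: have [nbl nbr] := farey_mediant nb1.
all: have [num den] := mediant_num_den nb1.
all: have [dp1 dq1] := (denq_gt0 p1, denq_gt0 q1).
all: have [qr|rq] := leP q (mediant p1 q1); 
  first by apply: (IH _ _ nbl) => //; rewrite den; lia.
all: have [rp|pr] := leP (mediant p1 q1) p; 
  first by apply: (IH _ _ nbr) => //; rewrite den; lia.
(* Here the mediant separates [p] from [q], so its denominator is at least [denq p + denq q]. But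
   [p] or [q] lies strictly inside [[p1, q1]] and has denominator at least that of the mediant: a
   contradiction. *)
all: have := @farey_den_between _ _ (mediant p1 q1) nb; rewrite pr rq den => /(_ isT) ge_r.
- have := @farey_den_between _ _ q nb1; rewrite [q < q1]lt_neqAle eq_sym q1q qq.
  by rewrite (le_lt_trans pp pq) => /(_ isT); lia.
- have := @farey_den_between _ _ p nb1; rewrite [p1 < p]lt_neqAle p1p pp.
  by rewrite (lt_le_trans pq qq) => /(_ isT); lia.
- have := @farey_den_between _ _ p nb1; rewrite [p1 < p]lt_neqAle p1p pp.
  by rewrite (lt_le_trans pq qq) => /(_ isT); lia.
Qed.

(** * Almost additivity of rho along the tree *)

Section Labels.
Context {R : realType}.
Implicit Types (x y z : R) (m : rat -> R).

(** [arcosh] is a choice operator, so its equation holds once a solution is exhibited: the logarithm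
    of the larger root of [X^2 - xX + 1 = 0]. *)
Lemma rho_spec x : 2 <= x -> 0 <= rho x /\ expR (rho x) + expR (- rho x) = x.
Proof.
move=> x2; pose s := Num.sqrt (x ^+ 2 - 4).
have s2 : s ^+ 2 = x ^+ 2 - 4 by rewrite sqr_sqrtr //; nra.
have s0 : 0 <= s by exact: sqrtr_ge0.
pose X := (x + s) / 2; have X1 : 1 <= X by rewrite /X; lra.
have X0 : 0 < X by lra.
have : [set y | 0 <= y /\ cosh y = x / 2] (ln X).
  split; first exact: ln_ge0.
  rewrite /cosh expRN lnK ?posrE //; congr (_ / _).
  apply: (mulfI (lt0r_neq0 X0)); rewrite mulrDr divff ?lt0r_neq0 // /X; nra.
move=> /getI [rho0 rhoE]; split=> //.
by move: rhoE; rewrite /cosh -/(arcosh _) -/(rho _) => rhoE; lra.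
Qed.

Lemma expR_rho x : 2 <= x -> let X := expR (rho x) in 1 <= X /\ X + X^-1 = x.
Proof.
by move=> /rho_spec[r0 rE]; rewrite /= -expRN rE -expR0 ler_expR.
Qed.

(** From [X >= 1] and [X^2 + 1 = xX >= 3X]. The bound 2 is what [near_product] asks for, and is why
    labels are taken to be at least 3 below. *)
Lemma expR_rho_ge2 x : 3 <= x -> 2 <= expR (rho x).
Proof.
move=> x3; have [|X1 XE] := @expR_rho x; first by lra.
have X0 : expR (rho x) != 0 by rewrite gt_eqF // expR_gt0.
have : expR (rho x) * (expR (rho x) + (expR (rho x))^-1) = expR (rho x) * x.
  by rewrite XE.
rewrite mulrDr divff // => H; nra.
Qed.

Lemma ln_dist (u v c : R) : 0 < c -> c <= u -> c <= v ->
  `|ln u - ln v| <= `|u - v| / c.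
Proof.
move=> c0; wlog uv : u v / v <= u.
  move=> H cu cv; have [/H|/ltW/H] := leP v u; first exact.
  by rewrite distrC [X in _ <= X / _]distrC; apply.
move=> cu cv; have v0 : 0 < v by lra.
have u0 : 0 < u by lra.
rewrite !ger0_norm ?subr_ge0 // ?ler_ln ?posrE //.
rewrite -ln_div ?posrE //; have -> : u / v = 1 + (u - v) / v.
  by field; rewrite lt0r_neq0.
apply: (@le_trans _ _ ((u - v) / v)).
  by apply: le_ln1Dx; rewrite (@lt_le_trans _ _ 0) // divr_ge0 ?subr_ge0 // ltW.
by apply: ler_wpM2l; rewrite ?subr_ge0 // lef_pV2 ?posrE.
Qed.

(* With [X = e^a], [Y = e^b] the cubic invariant factors as
   [(z - 2 cosh (a + b)) (z - 2 cosh (a - b))]; the hypothesis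
   [x y < 2 z] keeps the second factor away from [0]. *)
Lemma near_product (X Y Z K : R) : 2 <= X -> 2 <= Y -> 2 <= Z ->
  let x := X + X^-1 in let y := Y + Y^-1 in let z := Z + Z^-1 in
  x ^+ 2 + y ^+ 2 + z ^+ 2 - x * y * z - 4 = K -> 0 < 2 * z - x * y ->
  `|ln Z - ln (X * Y)| <= 32 * `|K| / (X * Y) ^+ 2.
Proof.
move=> X2 Y2 Z2 x y z KE dir.
have [X0 Y0 Z0] : [/\ 0 < X, 0 < Y & 0 < Z] by split; lra.
have [Xn Yn Zn] : [/\ X != 0, Y != 0 & Z != 0] by rewrite !gt_eqF.
pose S := X * Y.
have S4 : 4 <= S by rewrite /S; nra.
have S0 : 0 < S by lra.
have ZVle : Z^-1 <= 2^-1 by rewrite lef_pV2 ?posrE.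
(* The factor [z - 2 cosh (a + b)] is split once more, as [(Z - S) (1 - 1/(ZS))], to isolate
   [Z - S]. *)
have fact : (Z - S) * (1 - (Z * S)^-1) * (z - X / Y - Y / X) = K.
  by rewrite -KE /x /y /z /S; field; rewrite Xn Yn Zn.
have first_factor : 1 / 2 <= 1 - (Z * S)^-1.
  have : (Z * S)^-1 <= 2^-1 by rewrite lef_pV2 ?posrE //; nra.
  by lra.
(* By direction, [z - 2 cosh (a - b)] exceeds [2 sinh a sinh b], and [X - 1/X >= 3X/4] for [X >= 2];
   the resulting [9/32] is rounded down to [1/4]. *)
have second_factor : S / 4 <= z - X / Y - Y / X.
  have XV : X^-1 <= X / 4.
    by rewrite -(ler_pM2l X0) divff //; nra.
  have YV : Y^-1 <= Y / 4.
    by rewrite -(ler_pM2l Y0) divff //; nra.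
  have : (X - X^-1) * (Y - Y^-1) / 2 <= z - X / Y - Y / X.
    have -> : (X - X^-1) * (Y - Y^-1) / 2 = x * y / 2 - X / Y - Y / X.
      by rewrite /x /y; field; rewrite Xn Yn.
    by lra.
  have : (3 / 4 * X) * (3 / 4 * Y) <= (X - X^-1) * (Y - Y^-1).
    by apply: ler_pM; lra.
  rewrite /S; nra.
have dist : `|Z - S| <= 8 * `|K| / S.
  rewrite ler_pdivlMr // -fact !normrM.
  rewrite (ger0_norm (_ : 0 <= 1 - _)); last by lra.
  rewrite (ger0_norm (_ : 0 <= z - _ - _)); last by nra.
  have := normr_ge0 (Z - S); move: first_factor second_factor.
  move: `|Z - S| (1 - _) (z - _ - _) => A B C hB hC A0.
  have : 1 / 2 * (S / 4) <= B * C by apply: ler_pM; lra.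
  move=> h; have : A * (1 / 2 * (S / 4)) <= A * (B * C) by apply: ler_wpM2l.
  by lra.
(* Direction also keeps [Z] comparable to [S], so [ln_dist] applies with [c = S / 4], which turns
   the constant 8 into 32. *)
have ZS : S / 4 <= Z.
  have : S <= x * y.
    rewrite /S /x /y; apply: ler_pM; rewrite ?ltW // ltrDl invr_gt0 //.
  by rewrite /z in dir *; lra.
apply: (le_trans (@ln_dist _ _ (S / 4) _ ZS _)); [lra|rewrite -/S; lra|].
rewrite ler_pdivrMr; last by lra.
apply: (le_trans dist); rewrite -/S le_eqVlt; apply/orP; left; apply/eqP.
by field; rewrite gt_eqF.
Qed.

Lemma rho_near_additive x y z (K b : R) (k l : int) : 3 <= x -> 3 <= y -> 3 <= z ->
  expR (b * k%:~R) < x -> expR (b * l%:~R) < y ->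
  x ^+ 2 + y ^+ 2 + z ^+ 2 - x * y * z - 4 = K -> 0 < 2 * z - x * y ->
  `|rho z - rho x - rho y| <= 512 * `|K| * expR (- (2 * b * (k + l)%:~R)).
Proof.
move=> x3 y3 z3 bx bY KE dir.
have label (w : R) : 3 <= w -> 2 <= expR (rho w) /\ expR (rho w) + (expR (rho w))^-1 = w.
  by move=> w3; split; [exact: expR_rho_ge2|apply: (expR_rho _).2; lra].
have [[X2 XE] [Y2 YE]] := (label x x3, label y y3); have [Z2 ZE] := label z z3.
have := @near_product _ _ _ K X2 Y2 Z2.
rewrite XE YE ZE => /(_ KE dir).
rewrite lnM ?posrE ?expR_gt0 // !expRK -addrA -opprD => /le_trans; apply.
set X := expR (rho x) in X2 XE *; set Y := expR (rho y) in Y2 YE *.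
have XV : X^-1 <= 2^-1 by rewrite lef_pV2 ?posrE //; lra.
have YV : Y^-1 <= 2^-1 by rewrite lef_pV2 ?posrE //; lra.
(* Each of [X], [Y] is at least half its label, since [X >= x - 1/2]. The factor [1/4] is squared in
   the end, whence [512 = 32 * 16]. *)
have XY : expR (b * (k + l)%:~R) / 4 <= X * Y.
  have -> : expR (b * (k + l)%:~R) / 4
           = (expR (b * k%:~R) / 2) * (expR (b * l%:~R) / 2).
    by rewrite rmorphD mulrDr expRD; field.
  by apply: ler_pM; rewrite ?divr_ge0 ?expR_ge0 //; lra.
set E := expR (b * (k + l)%:~R) in XY *; have E0 : 0 < E by exact: expR_gt0.
have -> : expR (- (2 * b * (k + l)%:~R)) = (E ^+ 2)^-1.
  by rewrite expRN -expRM_natl mulrA.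
have -> : 512 * `|K| * (E ^+ 2)^-1 = 32 * `|K| / (E / 4) ^+ 2.
  by field; rewrite gt_eqF.
apply: ler_wpM2l; first by rewrite mulr_ge0.
rewrite lef_pV2 ?posrE ?exprn_gt0 ?divr_gt0 //; last by rewrite mulr_gt0 ?expR_gt0.
by rewrite ler_pXn2r ?nnegrE //; [lra|rewrite mulr_ge0 ?expR_ge0].
Qed.

End Labels.

(** * Chords of the encoding function and the Lipschitz bound for their error *)

Section Rising.
Context {R : realType}.
Implicit Types (m : rat -> R) (p q x y : rat).

Definition vieta m : Prop := forall q q0 q0', farey_parents q q0 q0' ->
  m (mediant q0 q) = m q0 * m q - m q0' /\
  m (mediant q q0') = m q * m q0' - m q0.

(** Shifted by 4 so that, for labels [2 cosh a], [2 cosh b], it vanishes exactly when the third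
    label is [2 cosh (a + b)] or [2 cosh (a - b)]. *)
Definition cubic m p q : R :=
  m p ^+ 2 + m q ^+ 2 + m (mediant p q) ^+ 2 - m p * m q * m (mediant p q) - 4.

Lemma farey01 : farey_neighbours 0 1.
Proof. by split. Qed.

(** Vieta jumping: the two labels at the ends of an edge are the two roots of the cubic, seen as a
    quadratic in one variable with the labels beside the edge fixed. *)
Lemma cubic_const m p q : vieta m -> farey_neighbours p q ->
  cubic m p q = cubic m 0 1.
Proof.
move=> mV nb; have [p0 pq q1 _] := nb.
apply: (farey_pair_ind (P := fun p q => cubic m p q = cubic m 0 1) farey01) => //.
move=> {p q nb p0 pq q1} p q nb <-.
by have [l r] := mV _ _ _ (farey_parents_mediant nb); rewrite /cubic l r; split; ring.
Qed.

(** The slope of the chord of [enc m], cleared of fractions: neighbours are at distance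
    [1 / (denq p * denq q)]. *)
Definition chord m p q : R :=
  (denq p)%:~R * rho (m q) - (denq q)%:~R * rho (m p).

Definition enc m x : R := rho (m x) / (denq x)%:~R.

Lemma denqR_gt0 x : 0 < (denq x)%:~R :> R.
Proof. by rewrite ltr0z. Qed.

Lemma ratrE x : ratr x = (numq x)%:~R / (denq x)%:~R :> R.
Proof. by []. Qed.

Lemma farey_dist p q : farey_neighbours p q ->
  ratr q - ratr p = ((denq p)%:~R * (denq q)%:~R)^-1 :> R.
Proof.
case=> _ _ _ /(congr1 (fun z : int => z%:~R : R)).
rewrite rmorphB !rmorphM rmorph1 /= !ratrE => det.
have := denqR_gt0 p; have := denqR_gt0 q => /lt0r_neq0 dq /lt0r_neq0 dp.
apply: (mulfI (mulf_neq0 dp dq)); rewrite mulfV ?mulf_neq0 // -[RHS]det.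
by field; rewrite dp dq.
Qed.

Lemma enc_chord m p q : farey_neighbours p q ->
  enc m q - enc m p = chord m p q * (ratr q - ratr p).
Proof.
move=> nb; rewrite farey_dist // /enc /chord.
have := denqR_gt0 p; have := denqR_gt0 q => /lt0r_neq0 dq /lt0r_neq0 dp.
by field; rewrite dp dq.
Qed.

(** Direction at the mediant [r] says [m r / 2 > (m p / 2) (m q / 2)], and denominators add under
    mediants, so a linear lower bound on the logarithm descends the tree. *)
Lemma log_growth m (c : R) p0 q0 : farey_neighbours p0 q0 ->
  (forall x, p0 <= x <= q0 -> 2 < m x) ->
  (forall x, p0 < x < q0 -> directed_away m x) ->
  c * (denq p0)%:~R <= ln (m p0 / 2) -> c * (denq q0)%:~R <= ln (m q0 / 2) ->
  forall x, p0 <= x <= q0 -> c * (denq x)%:~R <= ln (m x / 2).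
Proof.
move=> nb0 m2 away cp0 cq0; apply: (farey_point_ind nb0) => // p q nb pp0 qq0 cp cq.
have [_ ->] := mediant_num_den nb; rewrite rmorphD mulrDr.
have [[_ pr _ _] [_ rq _ _]] := farey_mediant nb.
have [p0r rq0] : p0 < mediant p q /\ mediant p q < q0.
  by split; [exact: le_lt_trans pr|exact: lt_le_trans rq _].
have := away (mediant p q); rewrite p0r rq0 => /(_ isT _ _ (farey_parents_mediant nb)).
have mp : 2 < m p by apply: m2; rewrite pp0 (ltW (lt_trans pr rq0)).
have mq : 2 < m q by apply: m2; rewrite qq0 (ltW (lt_trans p0r rq)).
move=> dir; apply: (le_trans (lerD cp cq)).
by rewrite -lnM ?posrE ?ler_ln ?posrE; nra.
Qed.

(** Induction down the Farey tree. The bound on either half carries an extra factor [exp(-w)] from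
    its larger denominators; this leaves room for the change of slope at the mediant, and [C] makes
    the balance exact. *)
Lemma chord_lipschitz m (w : R) p0 q0 : vieta m -> farey_neighbours p0 q0 -> 0 < w ->
  (forall x, p0 <= x <= q0 -> 3 <= m x /\ expR (w * (denq x)%:~R) < m x) ->
  (forall x, p0 < x < q0 -> directed_away m x) ->
  let C := 512 * `|cubic m 0 1| / (w * (1 - expR (- w))) in
  forall x y, p0 <= x -> x <= y -> y <= q0 ->
  `|enc m y - enc m x - chord m p0 q0 * (ratr y - ratr x)|
    <= C * expR (- (w * (denq p0 + denq q0)%:~R)) * (ratr y - ratr x).
Proof.
move=> mV nb0 w0 big away.
have D0 : 0 <= 512 * `|cubic m 0 1|.
  by apply: mulr_ge0; [exact: ler0n|exact: normr_ge0].
move: D0; set D := 512 * _ => D0; have DE : 512 * `|cubic m 0 1| = D by exact: erefl.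
move: D DE D0 => D DE D0 C x y p0x xy yq0.
have ew : expR (- w) < 1 by rewrite expR_lt1 oppr_lt0.
have C0 : 0 <= C.
  by apply: divr_ge0 => //; apply: mulr_ge0; rewrite ?subr_ge0 ltW.
pose tau (k : int) : R := C * expR (- (w * k%:~R)).
have tauS (k l : int) : 0 < l -> tau (k + l) <= tau k * expR (- w).
  move=> l0; rewrite /tau -[leRHS]mulrA -expRD; apply: ler_wpM2l => //; rewrite ler_expR.
  have : 1 <= l%:~R :> R by rewrite ler1z; lia.
  by rewrite rmorphD /=; nra.
(* The fuel [n] limits how far the denominators of [x] and [y] exceed [denq p + denq q]. At [n = 0]
   both points are endpoints, where the chord is exact. *)
suff main (n : nat) p q : farey_neighbours p q -> p0 <= p -> q <= q0 ->
    forall x y, p <= x -> x <= y -> y <= q ->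
    denq x < denq p + denq q + n%:Z -> denq y < denq p + denq q + n%:Z ->
    `|enc m y - enc m x - chord m p q * (ratr y - ratr x)|
      <= tau (denq p + denq q) * (ratr y - ratr x).
  by apply: (main (`|denq x| + `|denq y|)%N p0 q0) => //;
    have := denq_gt0 p0; have := denq_gt0 q0;
    have := denq_gt0 x; have := denq_gt0 y; lia.
elim: n p q => [|n IH] p q nb pp0 qq0 {p0x xy yq0}x {}y px xy yq dx dy.
  rewrite addr0 in dx dy.
  have tau0 : 0 <= tau (denq p + denq q) by rewrite mulr_ge0 // expR_ge0.
  have same z : `|enc m z - enc m z - chord m p q * (ratr z - ratr z)|
      <= tau (denq p + denq q) * (ratr z - ratr z).
    by rewrite !subrr !mulr0 subrr normr0.
  have pq : p < q by case: nb.
  have [->|xNy] := eqVneq x y; first exact: same.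
  have {}xy : x < y by rewrite lt_neqAle xNy.
  case: (farey_endpoints nb _ _ dx) => //; [exact: le_trans (ltW xy) yq| |] => xE; last first.
    by have := lt_le_trans xy yq; rewrite xE ltxx.
  case: (farey_endpoints nb _ _ dy) => //; [exact: le_trans px (ltW xy)| |] => yE.
    by have := le_lt_trans px xy; rewrite yE ltxx.
  rewrite xE yE enc_chord // subrr normr0 mulr_ge0 // subr_ge0 ler_rat.
  exact: ltW.
have [nbl nbr] := farey_mediant nb; have [_ den] := mediant_num_den nb.
have [[_ pr _ _] [_ rq _ _]] := (nbl, nbr).
set r := mediant p q in nbl nbr den pr rq *.
have [dp0 dq0] := (denq_gt0 p, denq_gt0 q).
pose delta := rho (m r) - rho (m p) - rho (m q).
set k := denq p + denq q in den dx dy *.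
have [p0r rq0] : p0 < r /\ r < q0.
  by split; [exact: le_lt_trans pr|exact: lt_le_trans rq _].
have deltaE : `|delta| <= D * expR (- (2 * w * k%:~R)).
  have [p3 pw] : 3 <= m p /\ expR (w * (denq p)%:~R) < m p.
    by apply: big; rewrite pp0 (ltW (lt_trans pr rq0)).
  have [q3 qw] : 3 <= m q /\ expR (w * (denq q)%:~R) < m q.
    by apply: big; rewrite qq0 (ltW (lt_trans p0r rq)).
  have [r3 _] : 3 <= m r /\ expR (w * (denq r)%:~R) < m r.
    by apply: big; rewrite !ltW.
  rewrite -DE; apply: rho_near_additive => //; first by rewrite -(cubic_const mV nb).
  by apply: (away r _ _ _ (farey_parents_mediant nb)); rewrite p0r.
(* Passes from the slope [s] of a half to that of [[p, q]], splitting [tau k] into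
   [tau k * expR (- w)] for the half and [tau k * (1 - expR (- w))] for the change of slope. *)
have slope (s e : R) : `|s - chord m p q| <= k%:~R * `|delta| ->
    forall z t, z <= t ->
    `|enc m t - enc m z - s * (ratr t - ratr z)| <= tau k * expR (- w) * (ratr t - ratr z) ->
    `|enc m t - enc m z - chord m p q * (ratr t - ratr z)| <= tau k * (ratr t - ratr z).
  move=> sE z t zt H.
  have zt0 : 0 <= ratr t - ratr z :> R by rewrite subr_ge0 ler_rat.
  have k0 : 0 <= k%:~R :> R by rewrite ler0z addr_ge0 // ltW.
  have kd : k%:~R * `|delta| <= tau k * (1 - expR (- w)).
    apply: (le_trans (ler_wpM2l k0 deltaE)).
    have -> : expR (- (2 * w * k%:~R)) = expR (- (w * k%:~R)) * expR (- (w * k%:~R)) :> R.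
      by rewrite -expRD; congr expR; ring.
    have -> : tau k * (1 - expR (- w)) =
        D * expR (- (w * k%:~R)) / w.
      by rewrite /tau /C; field; rewrite !gt_eqF ?subr_gt0.
    (* Half of the exponent in [exp(-2wk)] pays for the factor [k], by [1 + wk <= exp(wk)]. *)
    have : k%:~R * expR (- (w * k%:~R)) <= w^-1 :> R.
      rewrite expRN ler_pdivrMr ?expR_gt0 // mulrC ler_pdivlMr //.
      by rewrite mulrC; have := expR_ge1Dx (w * k%:~R); lra.
    have : 0 <= D * expR (- (w * k%:~R)) by apply: mulr_ge0 => //; exact: expR_ge0.
    move: D (expR _) {DE D0 C C0 tau tauS IH deltaE sE H} => A E AE kE.
    have -> : k%:~R * (A * (E * E)) = A * E * (k%:~R * E) by ring.
    exact: ler_wpM2l.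
  have -> : enc m t - enc m z - chord m p q * (ratr t - ratr z) =
     (enc m t - enc m z - s * (ratr t - ratr z))
     + (s - chord m p q) * (ratr t - ratr z) by ring.
  apply: (le_trans (ler_normD _ _)).
  rewrite normrM (ger0_norm zt0).
  have := ler_wpM2r zt0 (le_trans sE kd); lra.
have left_part z t : p <= z -> z <= t -> t <= r ->
    denq z < k + n.+1%:Z -> denq t < k + n.+1%:Z ->
    `|enc m t - enc m z - chord m p q * (ratr t - ratr z)| <= tau k * (ratr t - ratr z).
  move=> pz zt tr dz dt; apply: (slope (chord m p r)) => //.
    have -> : chord m p r - chord m p q = (denq p)%:~R * delta.
      by rewrite /chord /delta den /k rmorphD /=; ring.
    rewrite normrM ger0_norm ?ler0z ?(ltW dp0) //.
    by apply: ler_wpM2r; rewrite ?normr_ge0 // ler_int lerDl ltW.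
  apply: (le_trans (IH _ _ nbl _ _ _ _ pz zt tr _ _)) => //.
  - exact: ltW.
  - by rewrite den; clear -dz dp0; lia.
  - by rewrite den; clear -dt dp0; lia.
  apply: ler_wpM2r; first by rewrite subr_ge0 ler_rat.
  by rewrite den addrC; apply: tauS.
have right_part z t : r <= z -> z <= t -> t <= q ->
    denq z < k + n.+1%:Z -> denq t < k + n.+1%:Z ->
    `|enc m t - enc m z - chord m p q * (ratr t - ratr z)| <= tau k * (ratr t - ratr z).
  move=> rz zt tq dz dt; apply: (slope (chord m r q)) => //.
    have -> : chord m r q - chord m p q = - ((denq q)%:~R * delta).
      by rewrite /chord /delta den /k rmorphD /=; ring.
    rewrite normrN normrM ger0_norm ?ler0z ?(ltW dq0) //.
    by apply: ler_wpM2r; rewrite ?normr_ge0 // ler_int lerDr ltW.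
  apply: (le_trans (IH _ _ nbr _ _ _ _ rz zt tq _ _)) => //.
  - exact: ltW.
  - by rewrite den; clear -dz dq0; lia.
  - by rewrite den; clear -dt dq0; lia.
  apply: ler_wpM2r; first by rewrite subr_ge0 ler_rat.
  by rewrite den; apply: tauS.
have [yr|ry] := leP y r; first exact: left_part.
have [rx|xr] := leP r x; first exact: right_part.
have dr : denq r < k + n.+1%:Z by rewrite den ltrDl.
have := left_part x r px (ltW xr) (lexx _) dx dr.
have := right_part r y (lexx _) (ltW ry) yq dr dy.
have -> : enc m y - enc m x - chord m p q * (ratr y - ratr x) =
   (enc m y - enc m r - chord m p q * (ratr y - ratr r)) +
   (enc m r - enc m x - chord m p q * (ratr r - ratr x)) by ring.
move=> h1 h2; apply: (le_trans (ler_normD _ _)); lra.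
Qed.
End Rising.

(** * Continued fractions *)

Section Convergents.
Variable a : nat -> nat.
Hypothesis a_pos : forall i, (1 <= i)%N -> (1 <= a i)%N.

Local Notation C := (convergent a).

(** The continued fraction [[0, a_1, ..., a_j + x]] for [j >= 1]. The free tail [x] lets an
    induction on [j] absorb the last quotient, giving the usual Moebius formula. *)
Let tailed (j : nat) (x : rat) : rat :=
  foldr (fun b y => (b%:R + y)^-1) x [seq a i | i <- iota 1 j].

(* [(X_j, X_(j-1))] for the solution of [X_j = a_j X_(j-1) + X_(j-2)] with
   [X_(-1) = x] and [X_0 = y]. *)
Fixpoint continuant (x y : int) (j : nat) : int * int :=
  if j is i.+1 then
    let: (u, v) := continuant x y i in ((a i.+1)%:Z * u + v, u)
  else (y, x).

Local Notation num j := (continuant 1 0 j).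
Local Notation den j := (continuant 0 1 j).

Lemma continuant_den_gt0 j : 0 < (den j).1 /\ 0 <= (den j).2.
Proof.
elim: j => //= j; case: (den j) => u v /= [u0 v0].
by have := a_pos (ltn0Sn j); split; nia.
Qed.

Lemma continuant_det j : (num j).1 * (den j).2 - (num j).2 * (den j).1 = - (-1) ^+ j.
Proof.
elim: j => //= j; case: (num j) => u v; case: (den j) => u' v' /= IH.
by rewrite exprS mulN1r opprK -[RHS]opprK -IH; ring.
Qed.

Lemma tailedE j x : 0 <= x ->
  tailed j x = ((num j).1%:~R + x * (num j).2%:~R) / ((den j).1%:~R + x * (den j).2%:~R).
Proof.
elim: j x => [|j IH] x x0; first by rewrite /tailed /=; field.
have aj : 0 < (a j.+1)%:R + x :> rat.
  by rewrite ltr_wpDr // ltr0n; exact: a_pos.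
have -> : tailed j.+1 x = tailed j ((a j.+1)%:R + x)^-1.
  by rewrite /tailed -{1}(addn1 j) iotaD map_cat foldr_cat /= add1n.
rewrite IH ?invr_ge0 ?ltW //=.
have [] := continuant_den_gt0 j.
case: (num j) => u v; case: (den j) => u' v' /= u0 v0.
rewrite !rmorphD !rmorphM /= -!pmulrn.
have U0 : 0 < u'%:~R :> rat by rewrite ltr0z.
have V0 : 0 <= v'%:~R :> rat by rewrite ler0z.
move: aj; set A := (a j.+1)%:R => aj.
by field; rewrite !gt_eqF //; nra.
Qed.

Lemma convergent_continuant j :
  numq (C j) = (num j).1 /\ denq (C j) = (den j).1.
Proof.
have -> : C j = (num j).1%:~R / (den j).1%:~R.
  have := tailedE j (lexx 0); rewrite !mul0r !addr0 => <-.
  by rewrite /convergent /tailed; elim: (map _ _) => //= b s ->.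
(* The Bezout coefficients come from the determinant identity, multiplied by its own sign. *)
apply: (@bezout_fraction _ _ (- (-1) ^+ j * (den j).2) ((-1) ^+ j * (num j).2)).
  by case: (continuant_den_gt0 j).
transitivity (- (-1) ^+ j * ((num j).1 * (den j).2 - (num j).2 * (den j).1)); first by ring.
by rewrite continuant_det mulrNN -expr2 -exprM mulnC exprM sqrrN expr1n.
Qed.

Lemma convergent0 : numq (C 0) = 0 /\ denq (C 0) = 1.
Proof. by []. Qed.

Lemma convergent1 : numq (C 1) = 1 /\ denq (C 1) = a 1.
Proof. by have [-> ->] := convergent_continuant 1; rewrite /= mulr0 mulr1 addr0. Qed.

Lemma convergent_rec j :
  numq (C j.+2) = (a j.+2)%:Z * numq (C j.+1) + numq (C j) /\
  denq (C j.+2) = (a j.+2)%:Z * denq (C j.+1) + denq (C j).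
Proof.
have [-> ->] := convergent_continuant j.+2; have [-> ->] := convergent_continuant j.+1.
have [-> ->] := convergent_continuant j => /=.
by case: (num j) => u v; case: (den j).
Qed.

Lemma convergent_det j :
  numq (C j.+1) * denq (C j) - numq (C j) * denq (C j.+1) = (-1) ^+ j.
Proof.
have [-> ->] := convergent_continuant j.+1; have [-> ->] := convergent_continuant j.
move: (continuant_det j.+1) => /=; rewrite exprS mulN1r opprK.
by case: (num j) => u v; case: (den j).
Qed.

Lemma convergent_den_le j : denq (C j) <= denq (C j.+1).
Proof.
case: j => [|j].
  have [_ ->] := convergent0; have [_ ->] := convergent1.
  by have := a_pos (leqnn 1); lia.
have [_ ->] := convergent_rec j; have := a_pos (ltn0Sn j.+1).
by have := denq_gt0 (C j); have := denq_gt0 (C j.+1); nia.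
Qed.

Lemma convergent_den_ge j : j%:Z <= denq (C j).
Proof.
elim: j => [|[|j] IH]; [by []|by have := denq_gt0 (C 1); lia|].
have [_ ->] := convergent_rec j; have := a_pos (ltn0Sn j.+1).
by have := denq_gt0 (C j); have := denq_gt0 (C j.+1); nia.
Qed.

Lemma convergent_in01 j : 0 <= C j <= 1.
Proof.
rewrite !leq_cross -[numq 0]/(0 : int) -[denq 0]/(1 : int) -[numq 1]/(1 : int).
rewrite -[denq 1]/(1 : int) mul0r !mulr1 mul1r.
suff : (0 <= numq (C j) <= denq (C j)) && (0 <= numq (C j.+1) <= denq (C j.+1)).
  by case/andP.
elim: j => [|j /andP[/andP[n0 nd] /andP[n1 nd1]]].
  have [-> ->] := convergent0; have [-> ->] := convergent1.
  by have := a_pos (leqnn 1); lia.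
rewrite n1 nd1 /=; have [-> ->] := convergent_rec j.
by have := a_pos (ltn0Sn j.+1); nia.
Qed.

(** Even convergents lie below the limit and odd ones above, so parity decides which of [C j],
    [C j.+1] is the left end. *)
Definition conv_lo j : rat := if odd j then C j.+1 else C j.
Definition conv_hi j : rat := if odd j then C j else C j.+1.

Lemma farey_conv j : farey_neighbours (conv_lo j) (conv_hi j).
Proof.
have := convergent_det j; have [c0 c1] := andP (convergent_in01 j).
have [d0 d1] := andP (convergent_in01 j.+1).
rewrite /conv_lo /conv_hi -signr_odd; case: (odd j) => /= det.
all: by split; rewrite // ?ltq_cross; move: det; rewrite ?expr0 ?expr1; lia.
Qed.

Lemma conv_nested j : conv_lo j <= conv_lo j.+1 /\ conv_hi j.+1 <= conv_hi j.
Proof.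
have := convergent_det j; have [n2 d2] := convergent_rec j.
have := a_pos (ltn0Sn j.+1).
rewrite /conv_lo /conv_hi /= -signr_odd; case: (odd j) => /= a0 det.
all: by split; rewrite // leq_cross n2 d2; move: det; rewrite ?expr0 ?expr1; nia.
Qed.

Lemma conv_nested_le j k : (j <= k)%N -> conv_lo j <= conv_lo k /\ conv_hi k <= conv_hi j.
Proof.
elim: k => [|k IH]; first by rewrite leqn0 => /eqP ->.
rewrite leq_eqVlt => /predU1P[->//|]; rewrite ltnS => /IH[l h].
have [l' h'] := conv_nested k; split; first exact: le_trans l'.
exact: le_trans h.
Qed.

Lemma convergent_between j k : (j <= k)%N -> conv_lo j <= C k <= conv_hi j.
Proof.
move=> /conv_nested_le[l h]; have [_ /ltW lh _ _] := farey_conv k.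
have : conv_lo k <= C k <= conv_hi k.
  by move: lh; rewrite /conv_lo /conv_hi; case: (odd k) => ->; rewrite lexx.
by case/andP=> l' h'; rewrite (le_trans l l') (le_trans h' h).
Qed.

Lemma conv_den_add j : denq (conv_lo j) + denq (conv_hi j) = denq (C j) + denq (C j.+1).
Proof. by rewrite /conv_lo /conv_hi; case: odd => //; rewrite addrC. Qed.

Lemma conv_den_ge j x : conv_lo j <= x <= conv_hi j -> denq (C j) <= denq x.
Proof.
move=> /(farey_den_ge (farey_conv j)); apply: le_trans.
have := convergent_den_le j.
by rewrite /conv_lo /conv_hi; case: odd => d; rewrite le_min lexx ?d.
Qed.

End Convergents.

(** * The encoding function along the convergents *)

Section Approximation.
Context {R : realType}.
Implicit Types (Phi : R -> R) (m : rat -> R).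

Lemma ge0_at_rationals (h : R -> R) (b c x : R) : b < x < c ->
  {for x, continuous h} -> (forall q : rat, b < ratr q < c -> 0 <= h (ratr q)) ->
  0 <= h x.
Proof.
move=> bxc hc hq; rewrite leNgt; apply/negP => hx.
have /nbhs_ballP[e /= e0 he] : \forall y \near x, h y < 0 /\ b < y < c.
  near=> y; split; first by near: y; exact: (cvgr_lt (h x)).
  have : y \in `]b, c[ by near: y; apply: near_in_itvoo; rewrite in_itv.
  by rewrite in_itv.
have [q] := @rat_in_itvoo R (x - e) (x + e) ltac:(by rewrite ltrD2l gtrN).
rewrite in_itv /= => qx.
have [] := he (ratr q); first by rewrite /ball /= ltr_distlC.
by move=> hlt /hq; rewrite leNgt hlt.
Unshelve. all: by end_near.
Qed.

Definition near_affine m (p q : rat) (s c : R) : Prop :=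
  forall x y, p <= x -> x <= y -> y <= q ->
  `|enc m y - enc m x - s * (ratr y - ratr x)| <= c * (ratr y - ratr x).

(** Density of the rationals is used first in [y] with [x] rational, then in [x]. The first form
    admits endpoints as [x], which is needed to base the chord at a convergent. *)
Lemma encoding_lipschitz m Phi (p q : rat) (s c : R) :
  encoding_function m Phi -> 0 <= p -> q <= 1 -> near_affine m p q s c ->
  (forall (x : rat) (y : R), p <= x <= q -> ratr p < y < ratr q ->
    `|Phi y - Phi (ratr x) - s * (y - ratr x)| <= c * `|y - ratr x|) /\
  (forall x y : R, ratr p < x < ratr q -> ratr p < y < ratr q ->
    `|Phi y - Phi x - s * (y - x)| <= c * `|y - x|).
Proof.
move=> [cont _ val] p0 q1 lip.
have PhiE (x : rat) : p <= x <= q -> Phi (ratr x) = enc m x.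
  by move=> /andP[px xq]; rewrite val // (le_trans p0 px) (le_trans xq q1).
have lip_sym (x y : rat) : p <= x <= q -> p <= y <= q ->
    `|Phi (ratr y) - Phi (ratr x) - s * (ratr y - ratr x)| <= c * `|ratr y - ratr x|.
  move=> xpq ypq; rewrite !PhiE //.
  wlog xy : x y xpq ypq / x <= y.
    move=> H; have [xy|/ltW yx] := leP x y; first exact: H.
    have := H y x ypq xpq yx; rewrite (distrC (ratr x)); apply: le_trans.
    by rewrite -[leRHS]normrN le_eqVlt; apply/orP; left; apply/eqP; congr `|_|; ring.
  rewrite [X in _ <= _ * X]ger0_norm ?subr_ge0 ?ler_rat //.
  by apply: lip => //; [case/andP: xpq|case/andP: ypq].
have contPhi (x : R) : ratr p < x < ratr q -> {for x, continuous Phi}.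
  move=> /andP[px xq]; apply: (@within_continuous_continuous _ _ _ 0 1) => //.
  rewrite in_itv /= (le_lt_trans _ px) ?(lt_le_trans xq) //.
    by rewrite -[1](ratr_nat R 1) ler_rat.
  by rewrite -[0](ratr_nat R 0) ler_rat.
have conth z (x : R) : ratr p < x < ratr q ->
    {for x, continuous (fun y => c * `|y - z| - `|Phi y - Phi z - s * (y - z)|)}.
  move=> /contPhi cx.
  have cid : {for x, continuous (fun y : R => y - z)}.
    by apply: continuousB; [exact: cvg_id|exact: cvg_cst].
  apply: cvgB; first by apply: cvgM; [exact: cvg_cst|exact: (cvg_norm cid)].
  apply: (@cvg_norm _ _ _ _ _ (fun y => Phi y - Phi z - s * (y - z))).
  apply: cvgB; first by apply: cvgB => //; exact: cvg_cst.
  by apply: cvgM => //; exact: cvg_cst.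
have rational_real (x : rat) (y : R) : p <= x <= q -> ratr p < y < ratr q ->
    `|Phi y - Phi (ratr x) - s * (y - ratr x)| <= c * `|y - ratr x|.
  move=> xpq ypq; rewrite -subr_ge0.
  apply: (ge0_at_rationals ypq (conth (ratr x) y ypq)) => r.
  rewrite !ltr_rat subr_ge0 => /andP[pr rq]; apply: lip_sym => //.
  by rewrite (ltW pr) ltW.
split=> // x y xpq ypq; rewrite -subr_ge0.
apply: (ge0_at_rationals ypq (conth x y ypq)) => r.
rewrite !ltr_rat subr_ge0 => /andP[pr rq].
have := rational_real r x; rewrite (ltW pr) (ltW rq) => /(_ isT xpq).
rewrite (distrC x); apply: le_trans.
by rewrite -[leRHS]normrN le_eqVlt; apply/orP; left; apply/eqP; congr `|_|; ring.
Qed.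

End Approximation.

(** * Estimates on the Farey intervals between consecutive convergents *)

Section AlongConvergents.
Context {R : realType}.
Variables (m : rat -> R) (Phi : R -> R) (alpha : R) (a : nat -> nat).
Hypotheses (m_vieta : vieta m) (m_rising : rising m).
Hypotheses (m_Phi : encoding_function m Phi).
Hypotheses (alpha_irr : irrational alpha) (alpha_a : has_cfrac alpha a).

Local Notation C := (convergent a).
Local Notation lo := (conv_lo a).
Local Notation hi := (conv_hi a).
Local Notation v := (@conv_den R a).
Local Notation u := (@conv_num R a).
Local Notation r j := (rho (m (C j))).

Let a_pos : forall i, (1 <= i)%N -> (1 <= a i)%N.
Proof. by case: alpha_a. Qed.

Lemma conv_lo_ge0 j : 0 <= lo j.
Proof. by case: (farey_conv a_pos j). Qed.

Lemma conv_hi_le1 j : hi j <= 1.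
Proof. by case: (farey_conv a_pos j). Qed.

Lemma conv_lo_lt_hi j : lo j < hi j.
Proof. by case: (farey_conv a_pos j). Qed.

(** Nestedness and passage to the limit give weak inequalities; irrationality makes them strict. *)
Lemma alpha_between j : ratr (lo j) < alpha < ratr (hi j).
Proof.
have [_ cv] := alpha_a.
have neq (q : rat) : ratr q != alpha.
  by apply/eqP => qE; apply: alpha_irr; exists q.
rewrite !lt_neqAle neq [alpha == _]eq_sym neq /=; apply/andP; split.
  apply: (cvgr_to_ge cv); near=> k; rewrite ler_rat.
  by have /andP[] : lo j <= C k <= hi j by
    apply: convergent_between => //; near: k; exact: nbhs_infty_ge.
apply: (cvgr_to_le cv); near=> k; rewrite ler_rat.
by have /andP[] : lo j <= C k <= hi j by
  apply: convergent_between => //; near: k; exact: nbhs_infty_ge.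
Unshelve. all: by end_near.
Qed.

Lemma label_gt2 j x : lo j <= x <= hi j -> 2 < m x.
Proof.
case/andP=> lx xh; case: m_rising => gt2 _; apply: gt2.
by rewrite (le_trans (conv_lo_ge0 j) lx) (le_trans xh (conv_hi_le1 j)).
Qed.

(** The exceptional path is finite, while every fraction strictly inside the M-th interval has
    denominator greater than [M]. *)
Lemma eventually_away : exists J : nat, forall M, (J <= M)%N ->
  forall x, lo M < x < hi M -> directed_away m x.
Proof.
have [_ [s _ away]] := m_rising.
exists (\max_(x <- s) `|denq x|)%N => M JM x xM; have /andP[lx xh] := xM; apply: away.
  by rewrite (le_lt_trans (conv_lo_ge0 M) lx) (lt_le_trans xh (conv_hi_le1 M)).
apply/negP => xs.
have xJ : (`|denq x| <= M)%N by apply: leq_trans JM; exact: (leq_bigmax_seq _ xs).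
have := farey_den_between (farey_conv a_pos M) xM; rewrite conv_den_add.
have := convergent_den_ge a_pos M; have := denq_gt0 (C M.+1); clear -xJ.
lia.
Qed.

(** Beyond the exceptional path [log_growth] needs only the two endpoints of one interval; the
    smaller ratio [ln (m / 2) / denq] there serves as the rate. *)
Lemma exponential_growth : exists2 w : R, 0 < w & exists J : nat,
  forall x, lo J <= x <= hi J -> expR (w * (denq x)%:~R) < m x.
Proof.
have [J /(_ J (leqnn J)) away] := eventually_away.
have gt2 x := @label_gt2 J x.
have [lo2 hi2] : 2 < m (lo J) /\ 2 < m (hi J).
  by have lh := ltW (conv_lo_lt_hi J); split; apply: gt2; rewrite lexx ?lh.
pose w := Num.min (ln (m (lo J) / 2) / (denq (lo J))%:~R)
                  (ln (m (hi J) / 2) / (denq (hi J))%:~R).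
have w0 : 0 < w.
  by rewrite lt_min !divr_gt0 ?denqR_gt0 // ln_gt0 // ltr_pdivlMr // mul1r.
have wlo : w * (denq (lo J))%:~R <= ln (m (lo J) / 2).
  by rewrite -ler_pdivlMr ?denqR_gt0 // ge_min lexx.
have whi : w * (denq (hi J))%:~R <= ln (m (hi J) / 2).
  by rewrite -ler_pdivlMr ?denqR_gt0 // ge_min lexx orbT.
move: w w0 wlo whi => w w0 wlo whi; exists w => //; exists J => x xJ.
have mx : 2 < m x by exact: gt2.
have := log_growth (farey_conv a_pos J) gt2 away wlo whi xJ.
rewrite -[leLHS]expRK ler_ln ?posrE ?expR_gt0 //; last by lra.
by have := expR_gt0 (w * (denq x)%:~R); lra.
Qed.

Definition conv_slope j : R := chord m (lo j) (hi j).

Lemma conv_slopeE j : conv_slope j = (-1) ^+ j * (v j * r j.+1 - v j.+1 * r j).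
Proof.
rewrite /conv_slope /chord /conv_lo /conv_hi /conv_den -signr_odd.
by case: (odd j); rewrite ?expr0 ?expr1; ring.
Qed.

(** The value at [alpha] of the chord between [C j] and [C j.+1], weighted symmetrically in its two
    ends so that consecutive values telescope. *)
Definition conv_value j : R :=
  (-1) ^+ j * ((v j * alpha - u j) * r j.+1 - (v j.+1 * alpha - u j.+1) * r j).

Lemma conv_valueE j : conv_value j = enc m (C j) + conv_slope j * (alpha - ratr (C j)).
Proof.
rewrite conv_slopeE /enc ratrE -/(u j) -/(v j).
have v0 : v j != 0 by rewrite gt_eqF ?denqR_gt0.
have : u j.+1 * v j - u j * v j.+1 = (-1) ^+ j.
  by rewrite -!intrM -rmorphB convergent_det //= rmorphXn rmorphN1.
have : (-1) ^+ j * (-1) ^+ j = 1 :> R by rewrite -expr2 sqrr_sign.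
rewrite /conv_value; move: ((-1) ^+ j) => e e2 det; apply: (mulfI v0).
have -> : v j * (r j / v j + e * (v j * r j.+1 - v j.+1 * r j) * (alpha - u j / v j)) =
  r j * (e * e) + e * (v j * r j.+1 - v j.+1 * r j) * (v j * alpha - u j).
  by rewrite e2; field.
have -> : e * e = e * (u j.+1 * v j - u j * v j.+1) by rewrite det.
ring.
Qed.

Lemma conv_lipschitz (w : R) (J : nat) : 0 < w ->
  (forall x, lo J <= x <= hi J -> expR (w * (denq x)%:~R) < m x) ->
  exists2 c : R, 0 <= c & exists J' : nat, forall M, (J' <= M)%N ->
    near_affine m (lo M) (hi M) (conv_slope M) (c * expR (- (2 * w * v M))).
Proof.
move=> w0 big; have [J0 away] := eventually_away.
pose c := 512 * `|cubic m 0 1| / (w * (1 - expR (- w))).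
have c0 : 0 <= c.
  apply: divr_ge0; first by apply: mulr_ge0; [exact: ler0n|exact: normr_ge0].
  by rewrite mulr_ge0 ?ltW // subr_gt0 expR_lt1 oppr_lt0.
(* The three summands secure the growth bound, the edge directions, and [w * M >= 2]; the last gives
   labels at least 3 through [exp(t) >= 1 + t]. *)
exists c => //; exists (J + J0 + Num.bound (2 / w))%N => M JM x y lx xy yh.
have JM1 : (J <= M)%N by apply: leq_trans JM; rewrite -addnA leq_addr.
have JM2 : (J0 <= M)%N by apply: leq_trans JM; rewrite addnAC leq_addl.
have wM : 2 <= w * M%:R.
  rewrite -ler_pdivrMl // mulrC.
  have h : 0 <= 2 / w by rewrite divr_ge0 // ltW.
  apply: (le_trans (ltW (archi_boundP h))); rewrite ler_nat.
  by apply: leq_trans JM; rewrite leq_addl.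
have [lJ hJ] := conv_nested_le a_pos JM1.
have bigM z : lo M <= z <= hi M -> 3 <= m z /\ expR (w * (denq z)%:~R) < m z.
  move=> zM; have Ez : expR (w * (denq z)%:~R) < m z.
    by case/andP: zM => lz zh; apply: big; rewrite (le_trans lJ lz) (le_trans zh hJ).
  split=> //; apply: le_trans (ltW Ez); apply: le_trans (expR_ge1Dx _).
  have : M%:R <= (denq z)%:~R :> R.
    rewrite -[M%:R]/((M%:Z)%:~R) ler_int (le_trans (convergent_den_ge a_pos M)) //.
    exact: conv_den_ge.
  by move=> /(ler_wpM2l (ltW w0)); lra.
have := chord_lipschitz m_vieta (farey_conv a_pos M) w0 bigM (away M JM2) lx xy yh.
move/le_trans; apply; rewrite -/c; apply: ler_wpM2r.
  by rewrite subr_ge0 ler_rat.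
(* The exponent [w (v_M + v_(M+1))] is weakened to [2 w v_M], as denominators of convergents do not
   decrease. *)
apply: ler_wpM2l => //; rewrite ler_expR lerN2 conv_den_add rmorphD mulrDr.
have : v M <= (denq (C M.+1))%:~R by rewrite ler_int convergent_den_le.
by move=> /(ler_wpM2l (ltW w0)); rewrite /conv_den; lra.
Qed.

(** One Lipschitz bound used three times: from the base point [C M], at distance at most 1 from
    [alpha]; at the endpoints of a later interval; and from [alpha] itself. *)
Lemma conv_approx (w : R) (J : nat) : 0 < w ->
  (forall x, lo J <= x <= hi J -> expR (w * (denq x)%:~R) < m x) ->
  exists2 c : R, 0 <= c & exists J' : nat, forall M, (J' <= M)%N ->
  let e := c * expR (- (2 * w * v M)) in
  [/\ `|Phi alpha - conv_value M| <= e,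
      forall k, (M <= k)%N -> `|conv_slope k - conv_slope M| <= e &
      forall x, ratr (lo M) < x < ratr (hi M) ->
        `|Phi x - Phi alpha - conv_slope M * (x - alpha)| <= e * `|x - alpha|].
Proof.
move=> w0 /(conv_lipschitz w0)[c c0 [J' lip]]; exists c => //; exists J' => M JM e.
have e0 : 0 <= e by rewrite mulr_ge0 ?expR_ge0.
have [PhiQ PhiR] := encoding_lipschitz m_Phi (conv_lo_ge0 M) (conv_hi_le1 M) (lip M JM).
have := alpha_between M => aM; have CM := convergent_between a_pos (leqnn M).
have PhiC : Phi (ratr (C M)) = enc m (C M).
  by case: m_Phi => _ _ ->; last exact: convergent_in01.
split.
- rewrite conv_valueE opprD addrA -PhiC.
  apply: (le_trans (PhiQ _ _ CM aM)); apply: ler_piMr => //.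
  have [d0 d1] : 0 <= ratr (C M) :> R /\ ratr (C M) <= 1 :> R.
    have /andP[C0 C1] := convergent_in01 a_pos M.
    by split; [rewrite -[0](ratr_nat R 0)|rewrite -[1](ratr_nat R 1)]; rewrite ler_rat.
  have [l0 h1] : 0 <= ratr (lo M) :> R /\ ratr (hi M) <= 1 :> R.
    split; [rewrite -[0](ratr_nat R 0)|rewrite -[1](ratr_nat R 1)]; rewrite ler_rat.
      exact: conv_lo_ge0.
    exact: conv_hi_le1.
  by move: aM => /andP[aM1 aM2]; rewrite ler_norml; lra.
- move=> k Mk; have [l h] := conv_nested_le a_pos Mk.
  have lh := conv_lo_lt_hi k.
  have := lip M JM _ _ l (ltW lh) h; rewrite (enc_chord _ (farey_conv a_pos k)).
  rewrite -mulrBl normrM [X in _ * X]ger0_norm ?subr_ge0 ?ler_rat ?(ltW lh) //.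
  by rewrite ler_pM2r ?subr_gt0 ?ltr_rat.
- by move=> x xM; apply: PhiR.
Qed.

(** The j-th term is the difference of consecutive chord slopes, because
    [v_(j+1) - v_(j-1) = a_(j+1) v_j]. *)
Lemma slope_sumE M : slope_sum m a M = conv_slope M - conv_slope 0.
Proof.
rewrite /slope_sum; elim: M => [|M IH]; first by rewrite big_geq // subrr.
rewrite big_nat_recr //= IH !conv_slopeE /Delta_star /=.
have -> : v M.+2 = (a M.+2)%:R * v M.+1 + v M.
  by rewrite /conv_den (convergent_rec a_pos M).2 rmorphD rmorphM.
by rewrite exprS; ring.
Qed.

(** Same telescoping: [v_j alpha - u_j] satisfies the recursion of [v_j]. *)
Lemma value_sumE M : value_sum m a alpha M = conv_value M - conv_value 0.
Proof.
rewrite /value_sum; elim: M => [|M IH]; first by rewrite big_geq // subrr.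
rewrite big_nat_recr //= IH /conv_value /Delta_star /=.
have -> : v M.+2 = (a M.+2)%:R * v M.+1 + v M.
  by rewrite /conv_den (convergent_rec a_pos M).2 rmorphD rmorphM.
have -> : u M.+2 = (a M.+2)%:R * u M.+1 + u M.
  by rewrite /conv_num (convergent_rec a_pos M).1 rmorphD rmorphM.
by rewrite exprS; ring.
Qed.

End AlongConvergents.

(** * Limits of chord values and slopes, the derivative, and error rates *)

Section Limits.
Context {R : realType}.
Variables (m : rat -> R) (Phi : R -> R) (alpha : R) (a : nat -> nat).
Hypotheses (m_vieta : vieta m) (m_rising : rising m).
Hypotheses (m_Phi : encoding_function m Phi).
Hypotheses (alpha_irr : irrational alpha) (alpha_a : has_cfrac alpha a).

Let a_pos : forall i, (1 <= i)%N -> (1 <= a i)%N.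
Proof. by case: alpha_a. Qed.

Lemma expR_conv_den_cvg0 (w c e : R) : 0 < w -> 0 <= c -> 0 < e ->
  \forall M \near \oo, c * expR (- (2 * w * conv_den a M)) <= e.
Proof.
move=> w0 c0 e0; near=> M.
have wM : c / (2 * w * e) <= M%:R by near: M; exact: nbhs_infty_ger.
have Mv : M%:R <= conv_den a M :> R.
  by rewrite -[M%:R]/((M%:Z)%:~R) ler_int convergent_den_ge.
rewrite expRN ler_pdivrMr ?expR_gt0 //.
move: wM; rewrite ler_pdivrMr ?mulr_gt0 // => wM.
have := expR_ge1Dx (2 * w * conv_den a M) => /(ler_wpM2l (ltW e0)).
have w2e : 0 <= 2 * w * e by rewrite !mulr_ge0 // ltW.
have := ler_wpM2r w2e Mv; lra.
Unshelve. all: by end_near.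
Qed.

Local Notation value := (conv_value m alpha a).
Local Notation slope := (conv_slope m a).

(** Later slopes stay within the error of earlier ones, so the slopes are Cauchy. Their limit is
    shown to be the derivative; differentiability at [alpha] is obtained here, not assumed. *)
Lemma conv_limits : exists D : R,
  [/\ value M @[M --> \oo] --> Phi alpha, slope M @[M --> \oo] --> D &
      is_derive alpha 1 Phi D].
Proof.
have [w w0 [J big]] := exponential_growth m_rising alpha_a.
have [c c0 [J' approx]] := conv_approx m_vieta m_rising m_Phi alpha_irr alpha_a w0 big.
have small e : 0 < e -> exists2 M, (J' <= M)%N & c * expR (- (2 * w * conv_den a M)) <= e.
  move=> e0; have /= [N _ hN] := expR_conv_den_cvg0 w0 c0 e0.
  by exists (maxn J' N); [exact: leq_maxl|apply: hN; exact: leq_maxr].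
have cvgD : cvgn slope.
  apply: cauchy_cvg; apply: cauchy_exP => e e0.
  have e20 : 0 < e / 2 by rewrite divr_gt0.
  have [M JM le_e] := small _ e20; have [_ cauchyM _] := approx M JM.
  exists (slope M); exists M => // k /= Mk.
  rewrite /ball /= distrC (le_lt_trans (cauchyM k Mk)) // (le_lt_trans le_e) //.
  by rewrite ltr_pdivrMr // ltr_pMr // ltr1n.
have DM M : (J' <= M)%N -> `|limn slope - slope M| <= c * expR (- (2 * w * conv_den a M)).
  move=> JM; have [_ cauchyM _] := approx M JM.
  have : `|slope k - slope M| @[k --> \oo] --> `|limn slope - slope M|.
    by apply: cvg_norm; apply: cvgB => //; exact: cvg_cst.
  by move/cvgr_to_le; apply; exists M.
exists (limn slope); split; [|exact: cvgD|].
- apply/cvgrPdist_le => e e0; near=> M.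
  have JM : (J' <= M)%N by near: M; exact: nbhs_infty_ge.
  have [h _ _] := approx M JM; apply: (le_trans h); near: M.
  exact: expR_conv_den_cvg0.
have quotient : h^-1 *: (Phi (h *: (1 : R) + alpha) - Phi alpha) @[h --> 0^'] --> limn slope.
  apply/cvgrPdist_le => e e0.
  have e20 : 0 < e / 2 by rewrite divr_gt0.
  (* [M] is fixed first, so that the Lipschitz error and the distance from the M-th slope to the
     limit are both at most [e / 2]; then [h] is taken small enough to stay in that interval. *)
  have [M JM le_e] := small _ e20; have [_ _ lip] := approx M JM.
  have /andP[aM1 aM2] := alpha_between alpha_irr alpha_a M.
  near=> h.
  have h0 : h != 0 by near: h; exact: nbhs_dnbhs_neq.
  have hM : ratr (conv_lo a M) < h + alpha < ratr (conv_hi a M).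
    have : `|h| < Num.min (alpha - ratr (conv_lo a M)) (ratr (conv_hi a M) - alpha).
      by near: h; apply: dnbhs0_lt; rewrite lt_min !subr_gt0 aM1.
    by rewrite lt_min !ltr_norml; lra.
  have := lip _ hM; rewrite addrK => hq.
  have {}hq : `|h^-1 * (Phi (h + alpha) - Phi alpha) - slope M| <= e / 2.
    have -> : h^-1 * (Phi (h + alpha) - Phi alpha) - slope M =
        h^-1 * (Phi (h + alpha) - Phi alpha - slope M * h) by field.
    rewrite normrM normfV ler_pdivrMl ?normr_gt0 // [leRHS]mulrC.
    by apply: (le_trans hq); rewrite ler_pM2r ?normr_gt0.
  have := le_trans (DM M JM) le_e; rewrite /GRing.scale /= mulr1.
  have -> : limn slope - h^-1 * (Phi (h + alpha) - Phi alpha) =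
     (limn slope - slope M) - (h^-1 * (Phi (h + alpha) - Phi alpha) - slope M) by ring.
  by move=> hD; apply: (le_trans (ler_normB _ _)); lra.
apply: DeriveDef; first by apply/cvg_ex; exists (limn slope).
by apply/cvg_lim.
Unshelve. all: by end_near.
Qed.

Lemma conv_errors (w : R) : 0 < w ->
  (forall q : rat, 0 <= q <= 1 -> expR (w * (denq q)%:~R) < m q) ->
  (fun M => limn value - value M) =O_\oo (fun M => expR (- (2 * w * conv_den a M))) /\
  (fun M => limn slope - slope M) =O_\oo (fun M => expR (- (2 * w * conv_den a M))).
Proof.
move=> w0 big; have [D [cV cD _]] := conv_limits.
(* The growth hypothesis holds on all of [[0, 1]], so the estimates apply with the prescribed rate
   [w], starting from the interval of index 0. *)
have [|c c0 [J approx]] := conv_approx m_vieta m_rising m_Phi alpha_irr alpha_a (J := 0) w0.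
  by move=> x /andP[lx xh]; apply: big;
    rewrite (le_trans (conv_lo_ge0 alpha_a _) lx) (le_trans xh (conv_hi_le1 alpha_a _)).
have -> : limn value = Phi alpha by apply/cvg_lim.
have -> : limn slope = D by apply/cvg_lim.
(* The O-bound takes a positive constant, and [c] may be 0. *)
have c1 : 0 < c + 1 by lra.
have le_c M : c * expR (- (2 * w * conv_den a M))
    <= (c + 1) * `|expR (- (2 * w * conv_den a M)) : R|.
  by rewrite ger0_norm ?expR_ge0 // ler_wpM2r ?expR_ge0 // lerDl.
split; apply/eqO_exP; exists (c + 1) => //; exists J => // M /= JM;
  apply: (le_trans _ (le_c M)); have [h1 h2 _] := approx M JM; first exact: h1.
have : `|slope k - slope M| @[k --> \oo] --> `|D - slope M|.
  by apply: cvg_norm; apply: cvgB => //; exact: cvg_cst.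
by move/cvgr_to_le; apply; exists M.
Qed.

End Limits.

Theorem theorem8p3 (R : realType) (s0 u0 t0 : R) (m : rat -> R)
  (hT : markov_tree s0 u0 t0 m) (hrise : rising m)
  (Phi : R -> R) (hPhi : encoding_function m Phi)
  (alpha : R) (halpha : 0 < alpha < 1) (hirr : irrational alpha)
  (a : nat -> nat) (ha : has_cfrac alpha a) :
  [/\ cvgn (value_sum m a alpha) /\
      Phi alpha =
        (conv_num a 1%N - conv_den a 1%N * alpha) * rho (m 0)
        + alpha * rho (m (convergent a 1%N))
        + limn (value_sum m a alpha),
      [/\ cvgn (slope_sum m a),
          derivable Phi alpha 1 &
          derive1 Phi alpha =
            rho (m (convergent a 1%N)) - (a 1%N)%:R * rho (m 0)
            + limn (slope_sum m a)] &
      forall omega : R, 0 < omega ->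
        (forall q : rat, 0 <= q <= 1 -> expR (omega * (denq q)%:~R) < m q) ->
        (fun M : nat => limn (value_sum m a alpha) - value_sum m a alpha M)
          =O_\oo (fun M : nat => expR (- (2 * omega * conv_den a M))) /\
        (fun M : nat => limn (slope_sum m a) - slope_sum m a M)
          =O_\oo (fun M : nat => expR (- (2 * omega * conv_den a M)))].
Proof.
have mV : vieta m by case: hT.
have a_pos : forall i, (1 <= i)%N -> (1 <= a i)%N by case: ha.
have [D [cV cD dPhi]] := conv_limits mV hrise hPhi hirr ha.
have [n0 d0] := convergent0 a; have [_ d1] := convergent1 a_pos.
have c0 : convergent a 0 = 0 by [].
(* The terms outside the series are the value and slope of the chord over [[C_0, C_1]], where
   [C_0 = 0/1]; the telescoped sums start from this chord. *)
have value0 : conv_value m alpha a 0 =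
    (conv_num a 1 - conv_den a 1 * alpha) * rho (m 0) + alpha * rho (m (convergent a 1)).
  by rewrite /conv_value c0 /conv_num /conv_den n0 d0; ring.
have slope0 : conv_slope m a 0 = rho (m (convergent a 1)) - (a 1)%:R * rho (m 0).
  by rewrite conv_slopeE c0 /conv_den d0 d1 -pmulrn; ring.
have vE : value_sum m a alpha = (fun M => conv_value m alpha a M - conv_value m alpha a 0).
  by apply/funext => M; rewrite value_sumE.
have sE : slope_sum m a = (fun M => conv_slope m a M - conv_slope m a 0).
  by apply/funext => M; rewrite (slope_sumE _ ha).
have cvV : value_sum m a alpha @ \oo --> Phi alpha - conv_value m alpha a 0.
  by rewrite vE; apply: cvgB => //; exact: cvg_cst.
have cvS : slope_sum m a @ \oo --> D - conv_slope m a 0.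
  by rewrite sE; apply: cvgB => //; exact: cvg_cst.
have lV : limn (value_sum m a alpha) = Phi alpha - conv_value m alpha a 0.
  by apply/cvg_lim.
have lS : limn (slope_sum m a) = D - conv_slope m a 0 by apply/cvg_lim.
split.
- split; first by apply/cvg_ex; eexists; exact: cvV.
  by rewrite lV value0; ring.
- split; first by apply/cvg_ex; eexists; exact: cvS.
    by case: dPhi.
  by rewrite derive1E lS slope0; case: dPhi => _ ->; ring.
move=> w w0 big.
have [eV eS] := conv_errors mV hrise hPhi hirr ha w0 big.
have -> : (fun M : nat => limn (value_sum m a alpha) - value_sum m a alpha M) =
    (fun M => limn (conv_value m alpha a) - conv_value m alpha a M).
  apply/funext => M; rewrite lV value_sumE //.
  have -> : limn (conv_value m alpha a) = Phi alpha by apply/cvg_lim.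
  by ring.
have -> : (fun M : nat => limn (slope_sum m a) - slope_sum m a M) =
    (fun M => limn (conv_slope m a) - conv_slope m a M).
  apply/funext => M; rewrite lS (slope_sumE _ ha).
  have -> : limn (conv_slope m a) = D by apply/cvg_lim.
  by ring.
by split.
Qed.
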